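(* Let $\Bbbk$ be a perfect field and let $G=(V,E)$ be a graph with cone $\hat G=(\hat V,\hat E)$. If $I_{\mathrm{gl}(G)}$ is radical for some $d\in\mathbb N^V$, then $I_{\mathrm{gl}(\hat G)}$ is radical for all $\hat d\in\mathbb N^{\hat V}$ with $\hat d_v=d_v$ for all $v\in V$.
   Context: Graphs are finite, simple, undirected; all $d_v$ (and $\hat d_v$) are integers $\ge2$. For $G=(V,E)$ with $V=[N]=\{1,\dots,N\}$, the cone over $G$ is the graph $\hat G=(\hat V,\hat E)$ with $\hat V=V\cup\{0\}$ and $\hat E=E\cup\{(0,i):i\in[N]\}$. For a graph $G=(V,E)$ and $d=(d_v)_{v\in V}$, let $\mathcal X=\prod_{v\in V}[d_v]$. The global Markov ideal $I_{\mathrm{gl}(G)}\subseteq\Bbbk[p_x:x\in\mathcal X]$ (with respect to $d$) is generated by all binomials $p_{x_Ax_Bx_C}p_{x'_Ax'_Bx_C}-p_{x_Ax'_Bx_C}p_{x'_Ax_Bx_C}$, where $A,B,C$ range over all partitions $V=A\cup B\cup C$ into disjoint (possibly empty) sets such that every path in $G$ from a vertex of $A$ to a vertex of $B$ meets $C$, and $x_A,x'_A,x_B,x'_B,x_C$ range over all states of the respective subsets (elements of $\prod_{v\in A}[d_v]$, etc.). *)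

(* Defs.v *)
From HB Require Import structures.
From mathcomp Require Import all_boot all_order all_algebra all_field.
From mathcomp Require Import mpoly.

Set Implicit Arguments.
Unset Strict Implicit.
Unset Printing Implicit Defensive.

Import GRing.Theory.
Local Open Scope ring_scope.

Definition perfect_field (k : fieldType) : Prop :=
  forall q : {poly k}, irreducible_poly q -> separable_poly q.

(* Ideals are Prop-valued predicates: membership need not be decidable, so the
   boolean ideal structures of ring_quotient do not apply. *)

Definition ideal_gen (R : comNzRingType) (S : R -> Prop) (f : R) : Prop :=
  exists2 s : seq (R * R), (forall cg, cg \in s -> S cg.2)
                         & f = \sum_(cg <- s) cg.1 * cg.2.

Definition radical_ideal (R : comNzRingType) (I : R -> Prop) : Prop :=
  forall (f : R) (m : nat), I (f ^+ m) -> I f.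

(* The unqualified name symmetric is taken by mpoly (symmetric polynomials). *)
Record sgraph (V : finType) := SGraph {
  adj :> rel V;
  adj_sym : ssrbool.symmetric adj;
  adj_irrefl : irreflexive adj
}.

(* The apex 0 is None; the vertex v of G is Some v. *)
Definition cone_adj (V : finType) (G : sgraph V) : rel (option V) :=
  fun a b => match a, b with
             | Some u, Some v => G u v
             | None, None => false
             | _, _ => true
             end.

Lemma cone_adj_sym (V : finType) (G : sgraph V) : ssrbool.symmetric (cone_adj G).
Proof. by move=> [u|] [v|] //=; rewrite adj_sym. Qed.

Lemma cone_adj_irrefl (V : finType) (G : sgraph V) : irreflexive (cone_adj G).
Proof. by move=> [u|] //=; rewrite adj_irrefl. Qed.

Definition cone (V : finType) (G : sgraph V) : sgraph (option V) :=
  SGraph (cone_adj_sym G) (cone_adj_irrefl G).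

(* mathcomp's [partition] is not used because A, B, C may be empty. *)
Definition tripartition (V : finType) (A B C : {set V}) : Prop :=
  [/\ [disjoint A & B], [disjoint A & C], [disjoint B & C]
    & A :|: B :|: C = [set: V]].

Definition separates (V : finType) (G : sgraph V) (A B C : {set V}) : Prop :=
  forall (v : V) (s : seq V),
    path G v s -> uniq (v :: s) -> v \in A -> last v s \in B ->
    exists2 w, w \in v :: s & w \in C.

Section GlobalMarkov.
Variables (k : fieldType) (V : finType) (d : V -> nat).

Definition state : finType := {dffun forall v : V, 'I_(d v)}.

(* The state x_A x_B x_C for a partition of V into A, B, C. The substates are
   given by full states, of which only the restrictions to A, B and C matter;
   as they range over all states, their restrictions range over all substates
   that occur in some state. *)
Definition glue (A B : {set V}) (xA xB xC : state) : state :=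
  [ffun v : V => if v \in A then xA v else if v \in B then xB v else xC v].

Definition pring := {mpoly k[#|state|]}.

Definition pvar (x : state) : pring := 'X_(enum_rank x).

Definition markov_gen (G : sgraph V) (f : pring) : Prop :=
  exists A B C : {set V}, exists xA xA' xB xB' xC : state,
    [/\ tripartition A B C, separates G A B C
      & f = pvar (glue A B xA xB xC) * pvar (glue A B xA' xB' xC)
            - pvar (glue A B xA xB' xC) * pvar (glue A B xA' xB xC)].

Definition I_gl (G : sgraph V) : pring -> Prop := ideal_gen (markov_gen G).

End GlobalMarkov.

(* Main.v *)
(* The apex of the cone lies in [C] for every nontrivial separation, so the
   global Markov ideal of the cone is a sum of copies, in disjoint sets of
   variables, of that of [G], one for each state of the apex.  These ideals are
   generated by differences of monomials, so they are governed by a congruence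
   on monomials.  If the ideal of [G] is radical, then x^p ~ y^p and x^q ~ y^q
   with [p], [q] coprime imply x ~ y, and so does x^p ~ y^p in characteristic
   [p]; both properties pass to the cone.  Conversely they force a binomial
   ideal to be radical.  In characteristic [p] this is the additivity of
   Frobenius.  In characteristic 0, for a combination f = sum c_i m_i of
   inequivalent monomials with a power in the ideal, take a large prime [p] such
   that the [m_i ^ p] remain inequivalent: comparing coefficients in [f ^ p]
   expresses each [c_i ^ p] as [p] times an integral form of degree [p] in the
   [c_i], and a determinant argument modulo [p] gives [c_i = 0]. *)
From HB Require Import structures.
Require Import Defs.
From mathcomp Require Import all_boot all_order all_algebra all_field.
From mathcomp Require Import mpoly ssrcomplements.
From mathcomp Require Import boolp.

Set Implicit Arguments.
Unset Strict Implicit.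
Unset Printing Implicit Defensive.

Import GRing.Theory.
Local Open Scope ring_scope.

(** * Prime powers of sums, and vanishing by divisibility in characteristic 0 *)

(** The inner binomial coefficients of a prime exponent are divisible by [p]; the quotients are the
    coefficients of [Q]. *)
Lemma exprD_prime_homog (R : comNzRingType) (s d p : nat) (x y : {mpoly R[s]}) :
  prime p -> x \is d.-homog -> y \is d.-homog ->
  exists2 Q, Q \is (d * p).-homog & (x + y) ^+ p = x ^+ p + y ^+ p + Q *+ p.
Proof.
case: p => // q p_pr homx homy.
exists (\sum_(i < q)
  x ^+ (q.+1 - i.+1) * y ^+ i.+1 *+ ('C(q.+1, i.+1) %/ q.+1)).
  apply: rpred_sum => i _; apply: rpredMn.
  have -> : (d * q.+1 = d * (q.+1 - i.+1) + d * i.+1)%N.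
    by rewrite -mulnDr subnK // ltnS ltnW.
  by apply: dhomogM; apply: dhomogMn.
rewrite exprDn big_ord_recl big_ord_recr /= subn0 expr0 mulr1 bin0 mulr1n.
rewrite subnn expr0 mul1r binn mulr1n -addrA [_ + y ^+ _]addrC.
congr (_ + (_ + _)); rewrite -sumrMnl; apply: eq_bigr => i _.
rewrite -[RHS]mulrnA divnK; first by [].
by rewrite prime_dvd_bin //= ltnS; apply: ltn_ord.
Qed.

(** Over [int] this is a universal identity, which can be evaluated in any commutative ring. *)
Lemma expr_sumX_prime (R : comNzRingType) (s p : nat) : prime p ->
  exists2 Q : {mpoly R[s]}, Q \is p.-homog
    & (\sum_i 'X_i) ^+ p = \sum_i 'X_i ^+ p + Q *+ p.
Proof.
move=> p_pr; rewrite /index_enum; elim: (Finite.enum _) => [|i r [Q homQ IH]].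
  exists 0; first exact: rpred0.
  by rewrite !big_nil expr0n mul0rn addr0 (gtn_eqF (prime_gt0 p_pr)).
have homX j : 'X_j \is [in R[s], 1.-homog] by rewrite dhomogX /= mdeg1.
have [||T homT defT] :=
  @exprD_prime_homog R s 1 p 'X_i (\sum_(j <- r) 'X_j) p_pr.
- exact: homX.
- by apply: rpred_sum => j _; apply: homX.
exists (T + Q); first by rewrite mul1n in homT; apply: rpredD.
by rewrite !big_cons defT IH mulrnDl -!addrA [_ + T *+ _]addrC.
Qed.

(* A Nakayama argument: the monomials of degree [s * p] in the [c_i] span a
   finitely generated subgroup [W] of [k] with [W = p W], so a square integer
   matrix congruent to the identity modulo [p] kills its generators. *)
Lemma pdiv_homog_eq0 (k : fieldType) (s p : nat) (c : 'I_s -> k) :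
  [pchar k] =i pred0 -> prime p ->
  (forall i, exists2 P : {mpoly int[s]}, P \is p.-homog
     & c i ^+ p = mmap intr c P *+ p) ->
  forall i, c i = 0.
Proof.
(* A monomial of degree [N.+1], which exceeds [s * p], has some exponent at least [p]. Rewriting
   [c i ^+ p] there keeps the degree and brings out a factor [p]. *)
move=> k0 p_pr divc; pose N := (s * p)%N.
have divm (m : 'X_{1..s}) : mdeg m = N.+1 -> exists2 P : {mpoly int[s]},
    P \is N.+1.-homog & mmap1 c m = mmap intr c P *+ p.
  move=> degm; have [i le_p] : exists i, (p <= m i)%N.
    apply/existsP; apply: contra_eqT degm => /existsPn small.
    rewrite neq_ltn mdegE ltnS (leq_trans (n := (\sum_(i < s) p)%N)) //.
      by apply: leq_sum => i _; rewrite ltnW // ltnNge small.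
    by rewrite sum_nat_const card_ord.
  have [P homP cP] := divc i; pose m' := (m - U_(i) *+ p)%MM.
  have defm : (m = m' + U_(i) *+ p)%MM.
    apply/mnmP=> j; rewrite mnmDE mnmBE mulmnE mnm1E subnK //.
    by case: eqP => [<-|]; rewrite ?mul1n ?mul0n.
  exists ('X_[m'] * P).
    have -> : N.+1 = (mdeg m' + p)%N.
      by rewrite -degm defm mdegD mdegMn mdeg1 mul1n.
    by apply: dhomogM; rewrite ?dhomogX.
  rewrite rmorphM /= mmapX -mulrnAr -cP -(mmapX c intr m) defm mpolyXD rmorphM.
  by rewrite /= mmapX -mpolyXn rmorphXn /= mmapX mmap1U.
have intrMn (R : nzRingType) (b : int) n : (b *+ n)%:~R = b%:~R *+ n :> R.
  exact: rmorphMn.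
pose T := 'X_{1..s < N.+2}; pose n := #|{: T}|.
(* [T] also contains the lower degrees; their entries are set to 0, so their relations are
   trivial. *)
pose v := \col_(t < n) (if mdeg (enum_val t : T) == N.+1
                        then mmap1 c (enum_val t : T) else 0) : 'cV[k]_n.
have [B defB] : exists B : 'I_n -> 'I_n -> int,
    forall t, v t 0 = (\sum_u (B t u)%:~R * v u 0) *+ p.
  suff /fin_all_exists[B defB] : forall t : 'I_n, exists b : 'I_n -> int,
    v t 0 = (\sum_u (b u)%:~R * v u 0) *+ p by exists B.
  move=> t; rewrite mxE; case: eqP => [/divm[P homP ->]|_]; last first.
    by exists (fun=> 0); rewrite big1 ?mul0rn // => u _; rewrite mul0r.
  exists (fun u => P@_(enum_val u : T)); congr (_ *+ _).
  rewrite (mmapE N.+2).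
    rewrite (reindex (fun u : 'I_n => enum_val u : T)) /=; last first.
      by exists enum_rank => ? _; rewrite ?enum_valK ?enum_rankK.
    apply: eq_bigr => u _; rewrite mxE; case: ifPn => // deg_u.
    by rewrite (dhomog_nemf_coeff homP deg_u) !mul0r.
  rewrite msizeE; apply/bigmax_leqP_seq => m mP _.
  by rewrite (dhomog_mf homP mP).
pose M : 'M[int]_n := 1%:M - (\matrix_(t, u) B t u) *+ p.
have detM : \det M != 0.
  have : \det (map_mx intr M : 'M['F_p]_n) != 0.
    have -> : map_mx intr M = 1%:M :> 'M['F_p]_n.
      apply/matrixP=> t u; rewrite !mxE mulmxnE !mxE rmorphB /= !intrMn.
      have Fp0 (x : 'F_p) : x *+ p = 0 by apply: (mulrn_pchar (pchar_Fp p_pr)).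
      by rewrite Fp0 subr0.
    by rewrite det1 oner_eq0.
  by rewrite det_map_mx; apply: contraNneq => ->.
have Mv0 : map_mx intr M *m v = 0.
  apply/matrixP=> t z; rewrite (ord1 z) mxE [RHS]mxE.
  have defM u : map_mx intr M t u = (t == u)%:R - (B t u)%:~R *+ p :> k.
    by rewrite !mxE mulmxnE !mxE rmorphB /= !intrMn.
  under eq_bigr => u _ do rewrite defM mulrBl [_ *+ p * _]mulrnAl.
  rewrite sumrB sumrMnl -defB (bigD1 t) //= eqxx mul1r big1 ?addr0 ?subrr //.
  by move=> u /negbTE ne_ut; rewrite eq_sym ne_ut mul0r.
(* Multiplying by the adjugate gives [\det M] times [v] equal to 0, and a nonzero integer stays
   nonzero in characteristic 0. *)
have v0 : v = 0.
  have: \det (map_mx intr M : 'M[k]_n) *: v = 0.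
    by rewrite -mul_scalar_mx -mul_adj_mx -mulmxA Mv0 mulmx0.
  move/eqP; rewrite scaler_eq0 det_map_mx => /orP[|/eqP//].
  have nat0 m : (0 < m)%N -> m%:R != 0 :> k.
    by move=> m0; apply/negP => /(natf0_pchar m0)[q]; rewrite k0.
  by case: (\det M) detM => m m0; rewrite ?NegzE ?rmorphN ?oppr_eq0 /= -pmulrn
    (negbTE (nat0 _ _)) // lt0n.
move=> i; pose m := (U_(i) *+ N.+1)%MM : 'X_{1..s}.
have deg_m : (mdeg m < N.+2)%N by rewrite mdegMn mdeg1 mul1n.
have := congr1 (fun w : 'cV_n => w (enum_rank (BMultinom deg_m : T)) 0) v0.
rewrite !mxE enum_rankK /= mdegMn mdeg1 mul1n eqxx -(mmapX c intr).
by rewrite -mpolyXn rmorphXn /= mmapX mmap1U => /eqP; rewrite expf_eq0 => /eqP.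
Qed.

(** * Ideals given by generators, and cancellation of powers modulo radical ideals *)

Section IdealGen.
Variables (R : comNzRingType) (S : R -> Prop).
Local Notation I := (ideal_gen S).

Lemma ideal_gen_mem f : S f -> I f.
Proof.
move=> Sf; exists [:: (1, f)]; last by rewrite big_seq1 mul1r.
by move=> cg; rewrite inE => /eqP->.
Qed.

Lemma ideal_gen0 : I 0.
Proof. by exists [::]; rewrite ?big_nil. Qed.

Lemma ideal_genD f g : I f -> I g -> I (f + g).
Proof.
move=> [s Ss ->] [t St ->]; exists (s ++ t); last by rewrite big_cat.
by move=> cg; rewrite mem_cat => /orP[/Ss|/St].
Qed.

Lemma ideal_genM a f : I f -> I (a * f).
Proof.
move=> [s Ss ->]; exists [seq (a * cg.1, cg.2) | cg <- s].
  by move=> _ /mapP[cg /Ss Scg ->].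
by rewrite big_map mulr_sumr; apply: eq_bigr => cg _; rewrite mulrA.
Qed.

Lemma ideal_genN f : I f -> I (- f).
Proof. by rewrite -mulN1r; apply: ideal_genM. Qed.

Lemma ideal_gen_sum (T : Type) (r : seq T) (F : T -> R) :
  (forall t, I (F t)) -> I (\sum_(t <- r) F t).
Proof.
by move=> IF; apply: (big_ind I) => //; [apply: ideal_gen0|apply: ideal_genD].
Qed.

Lemma ideal_gen_trans y x z : I (x - y) -> I (y - z) -> I (x - z).
Proof. by move=> Ixy Iyz; rewrite -(subrKA y); apply: ideal_genD. Qed.

Lemma ideal_gen_subM x y z t : I (x - y) -> I (z - t) -> I (x * z - y * t).
Proof.
move=> Ixy Izt; apply: (@ideal_gen_trans (y * z)).
  by rewrite -mulrBl mulrC; apply: ideal_genM.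
by rewrite -mulrBr; apply: ideal_genM.
Qed.

Lemma ideal_gen_subX x y n : I (x - y) -> I (x ^+ n - y ^+ n).
Proof. by move=> Ixy; rewrite subrXX mulrC; apply: ideal_genM. Qed.

Lemma ideal_gen_expW x m n : (m <= n)%N -> I (x ^+ m) -> I (x ^+ n).
Proof. by move=> /subnK <-; rewrite exprD; apply: ideal_genM. Qed.

(** Bezout provides consecutive exponents [n] and [n.+1], whence [x ^+ n * (x - y)] and
    [y ^+ n * (x - y)] lie in the ideal. Radicality lowers [n] to 1, and [(x - y) ^+ 2] is the
    difference of the two resulting products. *)
Lemma radical_cancel_coprime x y p q :
  radical_ideal I -> coprime p q ->
  I (x ^+ p - y ^+ p) -> I (x ^+ q - y ^+ q) -> I (x - y).
Proof.
move=> radI co_pq Ip Iq.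
have [n In In1] : exists2 n, I (x ^+ n - y ^+ n) & I (x ^+ n.+1 - y ^+ n.+1).
  case: (posnP p) co_pq => [-> | p_gt0 /eqP co_pq].
    rewrite /coprime gcd0n => /eqP q1; rewrite q1 in Iq.
    by exists 0%N => //; rewrite !expr0 subrr; apply: ideal_gen0.
  case: (egcdnP q p_gt0) => u v; rewrite co_pq addn1 => Duv _; exists (v * q)%N.
    by rewrite mulnC !exprM; apply: ideal_gen_subX.
  by rewrite -Duv mulnC !exprM; apply: ideal_gen_subX.
have mulI z : I (z ^+ n * (x - y)) -> I (z * (x - y)).
  move=> Iz; apply: (radI _ n.+1).
  by rewrite exprMn exprSr [(x - y) ^+ _]exprS mulrACA mulrC; apply: ideal_genM.
have Ix : I (x * (x - y)).
  apply: mulI; rewrite mulrBr -exprSr mulrC.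
  apply: (ideal_gen_trans In1); rewrite exprS -mulrBr -opprB mulrN.
  by apply/ideal_genN/ideal_genM.
have Iy : I (y * (x - y)).
  apply: mulI; rewrite mulrBr -exprSr mulrC.
  apply: ideal_gen_trans In1; rewrite exprS -mulrBr -opprB mulrN.
  by apply/ideal_genN/ideal_genM.
apply: (radI _ 2%N); rewrite expr2 mulrBl; apply: ideal_genD => //.
exact: ideal_genN.
Qed.

Lemma radical_cancel_pchar x y p :
  radical_ideal I -> p \in [pchar R] -> I (x ^+ p - y ^+ p) -> I (x - y).
Proof.
move=> radI pR Ip; apply: (radI _ p).
by rewrite -(pFrobenius_autE pR) pFrobenius_autB_comm //; apply: mulrC.
Qed.

End IdealGen.

Lemma ideal_gen_morph (R R' : comNzRingType) (phi : {rmorphism R -> R'})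
    (S : R -> Prop) (S' : R' -> Prop) f :
  (forall g, S g -> ideal_gen S' (phi g)) ->
  ideal_gen S f -> ideal_gen S' (phi f).
Proof.
move=> S_phi [s Ss ->]; rewrite rmorph_sum.
rewrite big_seq; apply: (big_ind (ideal_gen S')).
- exact: ideal_gen0.
- exact: ideal_genD.
- by move=> cg /Ss/S_phi Scg; rewrite rmorphM; apply: ideal_genM.
Qed.

(** * Monomial congruences and binomial ideals *)

Section ClassSum.
Variables (k : fieldType) (n : nat) (r : 'X_{1..n} -> 'X_{1..n}) (h : 'X_{1..n}).

(** If [r] picks representatives of a monomial congruence, this is the coefficient of the image of
    [f] in the quotient algebra at the class represented by [h]. *)
Definition class_sum (f : {mpoly k[n]}) : k :=
  \sum_(m <- msupp f) f@_m * (r m == h)%:R.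

Lemma class_sumE w f : (msize f <= w)%N ->
  class_sum f = \sum_(m : 'X_{1..n < w}) f@_m * (r m == h)%:R.
Proof.
move=> le_fw; rewrite /class_sum (big_mksub 'X_{1..n < w}) ?msupp_uniq //=.
  rewrite big_rmcond //= => m /memN_msupp_eq0 ->.
  by rewrite mul0r.
by move=> x /msize_mdeg_lt /leq_trans; apply.
Qed.

Lemma class_sum_is_zmod_morphism : zmod_morphism class_sum.
Proof.
move=> f g; pose w := maxn (msize (f - g)) (maxn (msize f) (msize g)).
rewrite !(@class_sumE w) ?leq_max ?leqnn ?orbT // -sumrB.
by apply: eq_bigr => m _; rewrite mcoeffB mulrBl.
Qed.

HB.instance Definition _ :=
  GRing.isZmodMorphism.Build {mpoly k[n]} k class_sum class_sum_is_zmod_morphism.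

Lemma class_sumZX c m : class_sum (c *: 'X_[m]) = c * (r m == h)%:R.
Proof.
have [->|c0] := eqVneq c 0; first by rewrite scale0r raddf0 mul0r.
by rewrite /class_sum msuppMCX // big_seq1 mcoeffZ mcoeffX eqxx mulr1.
Qed.

End ClassSum.

Section BinomialIdeal.
Variables (k : fieldType) (n : nat) (S : {mpoly k[n]} -> Prop).
Local Notation I := (ideal_gen S).
Hypothesis S_binomial : forall g, S g -> exists a b, g = 'X_[a] - 'X_[b].

(** The predicate depends only on the class of [a], so [choose] returns the same representative
    throughout the class. *)
Definition congr_repr (a : 'X_{1..n}) : 'X_{1..n} :=
  choose (fun b => `[< I ('X_[b] - 'X_[a]) >]) a.
Local Notation r := congr_repr.

Lemma congr_reprP a : I ('X_[r a] - 'X_[a]).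
Proof.
rewrite /r; set P := (P in choose P); apply/asboolP/(@chooseP _ P).
by apply/asboolP; rewrite subrr; apply: ideal_gen0.
Qed.

Lemma congr_repr_eq a b : r a = r b <-> I ('X_[a] - 'X_[b]).
Proof.
split=> [rab|Iab].
  apply: (ideal_gen_trans _ (congr_reprP b)); rewrite -rab -opprB.
  exact/ideal_genN/congr_reprP.
have Iba : I ('X_[b] - 'X_[a]) by rewrite -opprB; apply: ideal_genN.
rewrite /r (@eq_choose _ _ (fun c => `[< I ('X_[c] - 'X_[b]) >])).
  by apply: choose_id; apply/asboolP; rewrite ?subrr //; apply: ideal_gen0.
by move=> c; apply/asboolP/asboolP => Ic; apply: (ideal_gen_trans Ic).
Qed.

Lemma congr_reprK a : r (r a) = r a.
Proof. exact/congr_repr_eq/congr_reprP. Qed.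

(** A monomial times a generator is a difference of two equivalent monomials, which cancel in every
    class sum. *)
Lemma class_sum_ideal f h : I f -> class_sum r h f = 0.
Proof.
move=> [s Ss ->]; rewrite raddf_sum big_seq big1 // => -[c g] /Ss /= Sg.
have [a [b def_g]] := S_binomial Sg; rewrite def_g in Sg *.
rewrite {1}(mpolyE c) mulr_suml raddf_sum big1 // => m _.
rewrite mulrBr -!scalerAl -!mpolyXD raddfB /= !class_sumZX.
suff -> : r (m + a) = r (m + b) by rewrite subrr.
apply/congr_repr_eq; rewrite !mpolyXD -mulrBr; apply: ideal_genM.
exact: ideal_gen_mem.
Qed.

Definition normal_form (f : {mpoly k[n]}) : {mpoly k[n]} :=
  \sum_(m <- msupp f) f@_m *: 'X_[r m].

Lemma normal_formP f : I (normal_form f - f).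
Proof.
rewrite {2}(mpolyE f) -sumrB; apply: ideal_gen_sum => m.
by rewrite -scalerBr -mul_mpolyC; apply/ideal_genM/congr_reprP.
Qed.

(** Consequently, distinct monomials of a normal form are inequivalent. *)
Lemma normal_form_repr f m : m \in msupp (normal_form f) -> r m = m.
Proof.
rewrite mcoeff_msupp /normal_form raddf_sum /=; apply: contraNeq => ne_rm.
rewrite big1 // => m' _; rewrite mcoeffZ mcoeffX.
have [def_m|_] := eqVneq (r m') m; last by rewrite mulr0.
by rewrite -def_m congr_reprK eqxx in ne_rm.
Qed.

Lemma normal_form_expI f j : I (f ^+ j) -> I (normal_form f ^+ j).
Proof.
move=> If; rewrite -(subrK (f ^+ j) (_ ^+ j)); apply: ideal_genD => //.
exact/ideal_gen_subX/normal_formP.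
Qed.

Lemma normal_form_eq0 f : normal_form f = 0 -> I f.
Proof.
by move=> f0; have := ideal_genN (normal_formP f); rewrite f0 sub0r opprK.
Qed.

(** For a normal form [g], Frobenius makes [g ^+ p] the sum of the powers of its terms. By
    cancellation only the term at [m0] meets the class of [m0 *+ p], so its coefficient would have
    to vanish. *)
Lemma binomial_radical_pchar p : p \in [pchar k] ->
  (forall a b, I ('X_[a] ^+ p - 'X_[b] ^+ p) -> I ('X_[a] - 'X_[b])) ->
  radical_ideal I.
Proof.
move=> p_k cancel; have p_pr := pcharf_prime p_k.
have p_kX : p \in [pchar {mpoly k[n]}] by rewrite pchar_lalg.
have rad_p f : I (f ^+ p) -> I f.
  move=> /normal_form_expI; set g := normal_form f => Ig.
  apply/normal_form_eq0/eqP; rewrite -msupp_eq0 -/g.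
  case def_s: (msupp g) => [//|m0 s]; have m0g : m0 \in msupp g.
    by rewrite def_s mem_head.
  have := class_sum_ideal (r (m0 *+ p)) Ig.
  rewrite {1}(mpolyE g) -(pFrobenius_autE p_kX) rmorph_sum raddf_sum /=.
  rewrite (bigD1_seq m0) ?msupp_uniq //= big1_seq => [|m /andP[ne_m mg]].
    rewrite addr0 pFrobenius_autE exprZn mpolyXn class_sumZX eqxx mulr1.
    by move/eqP; rewrite expf_eq0 mcoeff_eq0 m0g andbF.
  rewrite pFrobenius_autE exprZn mpolyXn class_sumZX.
  case: eqP => [|_]; last by rewrite mulr0.
  rewrite congr_repr_eq -!mpolyXn => /cancel/congr_repr_eq.
  by rewrite (normal_form_repr mg) (normal_form_repr m0g) => /eqP/idPn[].
(* Exponents [p ^ e] suffice, since [j] is at most [p ^ j]. *)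
have rad_pX e f : I (f ^+ (p ^ e)) -> I f.
  by elim: e f => // e IH f; rewrite expnSr exprM => /rad_p/IH.
move=> f j Ifj; apply: (rad_pX j).
by apply: ideal_gen_expW Ifj; apply/ltnW/ltn_expl/prime_gt1.
Qed.

(* Each pair of inequivalent monomials excludes at most one prime, since distinct
   primes are coprime. *)
Lemma prime_inj_powers s (mm : 'I_s -> 'X_{1..n}) e :
  (forall a b p q, coprime p q -> I ('X_[a] ^+ p - 'X_[b] ^+ p) ->
     I ('X_[a] ^+ q - 'X_[b] ^+ q) -> I ('X_[a] - 'X_[b])) ->
  exists2 p, prime p & (e <= p)%N /\ forall i j,
    I ('X_[mm i] ^+ p - 'X_[mm j] ^+ p) -> I ('X_[mm i] - 'X_[mm j]).
Proof.
move=> cancel.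
pose bad (ij : 'I_s * 'I_s) p := prime p /\
  I ('X_[mm ij.1] ^+ p - 'X_[mm ij.2] ^+ p).
(* [B ij] is a bad prime of the pair if there is one, and 0 otherwise. A larger bad prime is coprime
   to it, which forces equivalence. *)
have [B defB] : exists B : 'I_s * 'I_s -> nat, forall ij p, bad ij p ->
    (B ij < p)%N -> I ('X_[mm ij.1] - 'X_[mm ij.2]).
  suff /fin_all_exists[B defB] : forall ij, exists b : nat, forall p, bad ij p ->
    (b < p)%N -> I ('X_[mm ij.1] - 'X_[mm ij.2]) by exists B.
  move=> ij; have [[q [q_pr Iq]]|good] := pselect (exists q, bad ij q).
    exists q => p [p_pr Ip] lt_qp; apply: (cancel _ _ p q) => //.
    by rewrite prime_coprime // dvdn_prime2 // gtn_eqF.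
  by exists 0%N => p bad_p _; case: good; exists p.
have [p lt_p p_pr] := prime_above (maxn e (\max_ij B ij)).
move: lt_p; rewrite gtn_max => /andP[lt_ep lt_Bp].
exists p => //; split=> [|i j Ip]; first exact: ltnW.
by apply: (defB (i, j) p) => //; apply: leq_ltn_trans lt_Bp; apply: leq_bigmax.
Qed.

Lemma binomial_radical_pchar0 : [pchar k] =i pred0 ->
  (forall a b p q, coprime p q -> I ('X_[a] ^+ p - 'X_[b] ^+ p) ->
     I ('X_[a] ^+ q - 'X_[b] ^+ q) -> I ('X_[a] - 'X_[b])) ->
  radical_ideal I.
Proof.
move=> k0 cancel f e /normal_form_expI; set g := normal_form f => Ige.
apply: normal_form_eq0; rewrite -/g.
pose s := size (msupp g); pose mm (i : 'I_s) := tnth (in_tuple (msupp g)) i.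
have mm_supp i : mm i \in msupp g by apply: mem_tnth.
have mm_inj : injective mm by apply/tuple_uniqP/msupp_uniq.
have [p p_pr [le_ep inj_p]] := prime_inj_powers mm e cancel.
have Igp : I (g ^+ p) by apply: ideal_gen_expW Ige.
pose c i := g@_(mm i); pose y i := c i *: 'X_[mm i].
have def_g : g = \sum_i y i by rewrite {1}(mpolyE g) big_tnth.
(* The expansion is taken over [int] and then evaluated at the terms [y i] of [g]. *)
have [Q homQ defQ] := @expr_sumX_prime int s p p_pr.
have def_gp : g ^+ p = \sum_i y i ^+ p + mmap intr y Q *+ p.
  have := congr1 (mmap intr y) defQ.
  rewrite rmorphXn rmorphD rmorphMn !rmorph_sum /= => defQy.
  rewrite def_g; apply: etrans (etrans _ defQy) _; last first.
    congr (_ + _); apply: eq_bigr => i _.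
    by rewrite rmorphXn /= mmapX mmap1U.
  by congr (_ ^+ _); apply: eq_bigr => i _; rewrite mmapX mmap1U.
pose wt (a : 'X_{1..s}) := (\sum_i mm i *+ a i)%MM.
have yE a : mmap1 y a = mmap1 c a *: 'X_[wt a].
  rewrite /mmap1 /wt -mprodXnE -scaler_prod.
  by apply: eq_bigr => i _; rewrite exprZn.
suff c0 i : c i = 0.
  by rewrite def_g big1 // => i _; rewrite /y c0 scale0r.
move: i; apply: (pdiv_homog_eq0 k0 p_pr) => i; pose h := r (mm i *+ p).
(* [P] keeps the part of [Q] whose monomials land in the class [h]. The class sum of [g ^+ p] at [h]
   is 0, which reads [c i ^+ p] plus [p] times the value of [P]; hence the sign of the witness. *)
pose P : {mpoly int[s]} := \sum_(a <- msupp Q | r (wt a) == h) Q@_a *: 'X_[a].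
exists (- P).
  rewrite rpredN; rewrite /P big_seq_cond; apply: rpred_sum => a /andP[aQ _].
  by apply: rpredZ; rewrite dhomogX; apply/eqP; apply: (dhomog_mf homQ).
have := class_sum_ideal h Igp; rewrite def_gp raddfD raddfMn raddf_sum /=.
have -> : \sum_j class_sum r h (y j ^+ p) = c i ^+ p.
  rewrite (bigD1 i) //= big1 => [|j ne_ji].
    by rewrite addr0 exprZn mpolyXn class_sumZX eqxx mulr1.
  rewrite exprZn mpolyXn class_sumZX; case: eqP => [|_]; last by rewrite mulr0.
  rewrite congr_repr_eq -!mpolyXn => /inj_p/congr_repr_eq.
  rewrite !(normal_form_repr (mm_supp _)) => /mm_inj eq_ji.
  by rewrite eq_ji eqxx in ne_ji.
have -> : class_sum r h (mmap intr y Q) = mmap intr c P.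
  rewrite {1}/mmap raddf_sum /P raddf_sum [RHS]big_mkcond /=.
  apply: eq_bigr => a _; rewrite yE mulrzl -scaler_int scalerA class_sumZX.
  by case: eqP => _; rewrite ?mulr0 // mulr1 mmapZ mmapX.
by rewrite rmorphN mulNrn => /eqP; rewrite addr_eq0 => /eqP.
Qed.

End BinomialIdeal.

(** * Separation in a graph and in its cone *)

Lemma separatesC (V : finType) (G : sgraph V) (A B C : {set V}) :
  separates G A B C -> separates G B A C.
Proof.
move=> sepG v s Gs Us Bv As.
have def_rev : last v s :: rev (belast v s) = rev (v :: s).
  by rewrite [v :: s]lastI rev_rcons.
have last_rev : last (last v s) (rev (belast v s)) = v.
  by rewrite -[LHS]/(last v (_ :: _)) def_rev rev_cons last_rcons.
have [|||w] := sepG (last v s) (rev (belast v s)) _ _ As _.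
- by rewrite rev_path (eq_path (e' := G)) // => x y; apply: adj_sym.
- by rewrite def_rev rev_uniq.
- by rewrite last_rev.
by rewrite def_rev mem_rev; exists w.
Qed.

(** A path avoiding the apex is the image of a path in [G]; any other path meets the new separator
    at the apex. *)
Lemma cone_separates (V : finType) (G : sgraph V) (A B C : {set V}) :
  separates G A B C ->
  separates (cone G) (Some @: A) (Some @: B) (None |: Some @: C).
Proof.
move=> sepG [v|] s; last by move=> _ _ /imsetP[].
have [None_s|no_None] := boolP (None \in s).
  by move=> *; exists None; rewrite !inE ?None_s ?eqxx ?orbT.
have [t ->] : exists t : seq V, s = map Some t.
  elim: s no_None => [|[u|] s IH]; first by exists [::].
    by rewrite inE => /IH[t ->]; exists (u :: t).
  by rewrite inE.
rewrite -[Some v :: _]/(map Some (v :: t)) path_map (map_inj_uniq Some_inj).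
rewrite last_map !(mem_imset _ _ Some_inj) => Gt Ut Av Bt.
have [w w_t Cw] := sepG v t Gt Ut Av Bt; exists (Some w).
  by rewrite (mem_map Some_inj).
by rewrite !inE (mem_imset _ _ Some_inj) Cw.
Qed.

Lemma separates_cone (V : finType) (G : sgraph V) (A B C : {set option V}) :
  separates (cone G) A B C ->
  separates G (Some @^-1: A) (Some @^-1: B) (Some @^-1: C).
Proof.
move=> sepG v s Gs Us; rewrite !inE -last_map => Av Bs.
have [||[w|] w_s Cw] := sepG (Some v) (map Some s) _ _ Av Bs.
- by rewrite path_map.
- by rewrite -[Some v :: _]/(map Some (v :: s)) (map_inj_uniq Some_inj).
- by exists w; rewrite ?inE // -(mem_map Some_inj).
- by have /mapP[] : None \in map Some (v :: s) by [].
Qed.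

(** The apex is adjacent to every other vertex, so a vertex of [B] would be joined to it by an edge
    that misses [C]. *)
Lemma cone_apex_separates (V : finType) (G : sgraph V) (A B C : {set option V}) :
  separates (cone G) A B C -> [disjoint A & C] -> [disjoint B & C] ->
  [disjoint A & B] -> None \in A -> B = set0.
Proof.
move=> sepG dAC dBC dAB A0; apply/setP => b; rewrite inE; apply/negP => Bb.
have b0 : b != None by apply: contraTneq Bb => ->; rewrite (disjointFr dAB).
have [||w] := sepG None [:: b] _ _ A0 Bb.
- by case: b b0 {Bb}.
- by rewrite /= inE eq_sym b0.
by rewrite !inE => /orP[]/eqP->; rewrite ?(disjointFr dAC A0) ?(disjointFr dBC Bb).
Qed.

(** * Slices of the cone ideal by the state of the apex *)

Section ConeSlices.
Variables (k : fieldType) (V : finType) (G : sgraph V) (dhat : option V -> nat).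
Local Notation d := (fun v => dhat (Some v)).

Definition cone_state (j : 'I_(dhat None)) (x : state d) : state dhat :=
  [ffun a : option V => match a return 'I_(dhat a) with
                        | None => j
                        | Some v => x v
                        end].

Definition base_state (y : state dhat) : state d :=
  [ffun v : V => y (Some v)].

Lemma base_stateK (y : state dhat) : cone_state (y None) (base_state y) = y.
Proof. by apply/ffunP => -[v|]; rewrite !ffunE. Qed.

Lemma cone_state_glue j (A B : {set V}) xA xB xC :
  cone_state j (glue A B xA xB xC) =
  glue (Some @: A) (Some @: B)
    (cone_state j xA) (cone_state j xB) (cone_state j xC).
Proof.
apply/ffunP => -[v|]; rewrite !ffunE; first by rewrite !(mem_imset _ _ Some_inj).
have noneF (D : {set V}) : None \in Some @: D = false by apply/imsetP=> -[].
by rewrite !noneF.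
Qed.

Lemma base_state_glue (A B : {set option V}) yA yB yC :
  base_state (glue A B yA yB yC) =
  glue (Some @^-1: A) (Some @^-1: B)
    (base_state yA) (base_state yB) (base_state yC).
Proof. by apply/ffunP => v; rewrite !ffunE !inE. Qed.

Local Notation slice_in j :=
  (mmap (@mpolyC _ k) (fun i => pvar k (cone_state j (enum_val i)))).

(** Variables of other slices go to 1 rather than 0, so a monomial is sent to its factor in slice
    [j], read in the ring of [G]. *)
Local Notation slice_out j :=
  (mmap (@mpolyC _ k) (fun i => let y : state dhat := enum_val i in
                          if y None == j then pvar k (base_state y) else 1)).

Lemma slice_in_pvar j x : slice_in j (pvar k x) = pvar k (cone_state j x).
Proof. by rewrite mmapX mmap1U enum_rankK. Qed.

Lemma slice_out_pvar j (y : state dhat) :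
  slice_out j (pvar k y) = if y None == j then pvar k (base_state y) else 1.
Proof. by rewrite mmapX mmap1U enum_rankK. Qed.

Lemma slice_in_ideal j f : I_gl G f -> I_gl (cone G) (slice_in j f).
Proof.
apply: ideal_gen_morph => _ [A [B [C [xA [xA' [xB [xB' [xC [triABC sepABC ->]]]]]]]]].
apply: ideal_gen_mem; rewrite rmorphB !rmorphM /= !slice_in_pvar !cone_state_glue.
exists (Some @: A), (Some @: B), (None |: Some @: C), (cone_state j xA),
  (cone_state j xA'), (cone_state j xB), (cone_state j xB'), (cone_state j xC).
split=> //; last exact: cone_separates.
case: triABC => dAB dAC dBC coverABC.
have noneF (D : {set V}) : None \in Some @: D = false by apply/imsetP=> -[].
have SomeI (D E : {set V}) :
    [disjoint D & E] -> [disjoint Some @: D & None |: Some @: E].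
  move=> dDE; rewrite -setI_eq0; apply/eqP/setP=> -[v|]; rewrite !inE ?noneF //=.
  by rewrite !(mem_imset _ _ Some_inj); apply/andP=> -[/(disjointFr dDE)->].
split; [|exact: SomeI|exact: SomeI|].
  exact: disjointWr (subsetUr _ _) (SomeI _ _ dAB).
apply/setP => -[v|]; rewrite !inE ?eqxx ?orbT //= !(mem_imset _ _ Some_inj).
by have /setP/(_ v) := coverABC; rewrite !inE.
Qed.

(** If the apex lies in [A] or [B], the other side is empty and the generator is 0. Otherwise its
    four variables share one slice, so it becomes a generator for [G] or [1 - 1]. *)
Lemma slice_out_ideal j f : I_gl (cone G) f -> I_gl G (slice_out j f).
Proof.
apply: ideal_gen_morph => _ [A [B [C [yA [yA' [yB [yB' [yC [triABC sepABC ->]]]]]]]]].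
case: triABC => dAB dAC dBC coverABC.
have [A0|A0] := boolP (None \in A).
  rewrite (cone_apex_separates sepABC) //.
  have eqB x z : glue A set0 x yB z = glue A set0 x yB' z.
    by apply/ffunP=> a; rewrite !ffunE inE.
  by rewrite !eqB subrr rmorph0; apply: ideal_gen0.
have [B0|B0] := boolP (None \in B).
  rewrite (cone_apex_separates (separatesC sepABC)) // 1?disjoint_sym //.
  have eqA x z : glue set0 B yA x z = glue set0 B yA' x z.
    by apply/ffunP=> a; rewrite !ffunE inE.
  by rewrite !eqA mulrC subrr rmorph0; apply: ideal_gen0.
have glue0 x y : glue A B x y yC None = yC None.
  by rewrite ffunE (negbTE A0) (negbTE B0).
rewrite rmorphB !rmorphM /= !slice_out_pvar !glue0.
case: eqP => _; last by rewrite subrr; apply: ideal_gen0.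
apply: ideal_gen_mem; rewrite !base_state_glue.
exists (Some @^-1: A), (Some @^-1: B), (Some @^-1: C), (base_state yA),
  (base_state yA'), (base_state yB), (base_state yB'), (base_state yC).
split=> //; last exact: separates_cone.
have preimI (D E : {set option V}) :
    [disjoint D & E] -> [disjoint Some @^-1: D & Some @^-1: E].
  by rewrite -!setI_eq0 -preimsetI => /eqP->; rewrite preimset0.
split; [exact: preimI | exact: preimI | exact: preimI | ].
by apply/setP=> v; have /setP/(_ (Some v)) := coverABC; rewrite !inE.
Qed.

(** By multiplicativity a single variable suffices, and its factor differs from 1 only in the slice
    of its own apex state. *)
Lemma slice_prod (a : 'X_{1..#|state dhat|}) :
  'X_[a] = \prod_j slice_in j (slice_out j 'X_[k, a]).
Proof.
transitivity (\prod_(i < #|state dhat|)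
    (\prod_j slice_in j (slice_out j ('X_i : pring k dhat))) ^+ a i).
  rewrite mpolyXE_id; apply: eq_bigr => i _; congr (_ ^+ _).
  rewrite -(enum_valK i); set y := enum_val i.
  rewrite -[X in X = _]/(pvar k y) (bigD1 (y None)) //= big1 => [|j ne_j].
    by rewrite mulr1 slice_out_pvar eqxx slice_in_pvar base_stateK.
  by rewrite slice_out_pvar eq_sym (negbTE ne_j) rmorph1.
rewrite [RHS](eq_bigr (fun j => \prod_(i < #|state dhat|)
    slice_in j (slice_out j ('X_i : pring k dhat)) ^+ a i)) => [|j _].
  by rewrite exchange_big; apply: eq_bigr => i _; rewrite prodrXl.
by rewrite mpolyXE_id !rmorph_prod; apply: eq_bigr => i _; rewrite !rmorphXn.
Qed.

(** Congruences in the slices multiply to one in the cone; this carries cancellation of powers from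
    [G] to the cone. *)
Lemma cone_congr (a b : 'X_{1..#|state dhat|}) :
  (forall j, I_gl G (slice_out j 'X_[k, a] - slice_out j 'X_[k, b])) ->
  I_gl (cone G) ('X_[k, a] - 'X_[k, b]).
Proof.
move=> Iab; rewrite (slice_prod a) (slice_prod b).
apply: (big_ind2 (fun x y => I_gl (cone G) (x - y))).
- by rewrite subrr; apply: ideal_gen0.
- by move=> *; apply: ideal_gen_subM.
by move=> j _; rewrite -rmorphB; apply: slice_in_ideal.
Qed.

Lemma radical_cone :
  radical_ideal (@I_gl k V d G) -> radical_ideal (@I_gl k (option V) dhat (cone G)).
Proof.
move=> radG.
have outI j a b p : I_gl (cone G) ('X_[k, a] ^+ p - 'X_[k, b] ^+ p) ->
    I_gl G (slice_out j 'X_[k, a] ^+ p - slice_out j 'X_[k, b] ^+ p).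
  by move=> /(slice_out_ideal j); rewrite rmorphB !rmorphXn.
have binom (g : pring k dhat) : markov_gen (cone G) g -> exists a b, g = 'X_[k, a] - 'X_[k, b].
  move=> [A [B [C [yA [yA' [yB [yB' [yC [_ _ ->]]]]]]]]].
  by rewrite /pvar -!mpolyXD; do 2!eexists.
have [[p p_k]|k0] := pselect (exists p, p \in [pchar k]).
  refine (binomial_radical_pchar binom p_k _) => a b Iab; apply: cone_congr => j.
  by apply: (radical_cancel_pchar radG) (outI j _ _ _ Iab); rewrite pchar_lalg.
refine (binomial_radical_pchar0 binom _ _) => [p|a b p q co_pq Ip Iq].
  by apply/negP => p_k; case: k0; exists p.
by apply: cone_congr => j; apply: (radical_cancel_coprime radG co_pq); apply: outI.
Qed.

End ConeSlices.

Local Close Scope ring_scope.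

Theorem lemma4p7 (k : fieldType) (V : finType) (G : sgraph V) (d : V -> nat) :
  perfect_field k ->
  (forall v : V, 2 <= d v) ->
  radical_ideal (@I_gl k V d G) ->
  forall dhat : option V -> nat,
    (forall a : option V, 2 <= dhat a) ->
    (forall v : V, dhat (Some v) = d v) ->
    radical_ideal (@I_gl k (option V) dhat (cone G)).
Proof.
move=> _ _ radG dhat _ dhatE; apply: radical_cone.
(* The type of states depends on the function [d], so the pointwise equality must become an equality
   of functions. *)
by rewrite (funext dhatE).
Qed.
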